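(* Let $\alpha$ and $\beta$ be finite sequences of positive integers, each with an even number of elements, and let $a=\breve K(\alpha)$, $b=\breve K(\alpha\beta)$ and $c=\breve K(\beta)$. Then $$\tilde\Sigma\Big((\alpha,a),(\alpha\beta,b),(\beta,c)\Big)=\frac{\breve K(\alpha^2)}{\breve K(\alpha)}\,b-c .$$
   Context: Concatenation of finite sequences $\alpha,\beta$ is written $\alpha\beta$ or $\alpha\oplus\beta$; $\alpha^2=\alpha\alpha$. Continuants: $K_0()=1$, $K_1(x_1)=x_1$, $K_n(x_1,\ldots,x_n)=x_nK_{n-1}(x_1,\ldots,x_{n-1})+K_{n-2}(x_1,\ldots,x_{n-2})$. For $\alpha=(a_1,\ldots,a_n)$ put $K(\alpha)=K_n(a_1,\ldots,a_n)$ and $\breve K(\alpha)=K_{n-1}(a_1,\ldots,a_{n-1})$. The operation $\tilde\Sigma$ is defined on triples of pairs (sequence, integer) by $$\tilde\Sigma\big((\alpha_1,a_1),(\alpha_2,a_2),(\alpha_3,a_3)\big)=\breve K(\alpha_1\oplus\alpha_2),$$ so that the left-hand side of the claim is $\breve K(\alpha\oplus\alpha\beta)=\breve K(\alpha^2\beta)$. *)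

(* Defs.v *)
From mathcomp Require Import all_boot all_order all_algebra.

Set Implicit Arguments.
Unset Strict Implicit.
Unset Printing Implicit Defensive.

Import Order.TTheory GRing.Theory Num.Theory.
Local Open Scope ring_scope.

(* [continuant_rec x n] is K_n(x_1, ..., x_n), with x_i stored as [x i.-1]. *)
Fixpoint continuant_rec (x : nat -> int) (n : nat) : int :=
  match n with
  | 0 => 1
  | 1 => x 0%N
  | (m.+1 as k).+1 => x k * continuant_rec x k + continuant_rec x m
  end.

Definition continuant (s : seq int) : int := continuant_rec (nth 0 s) (size s).

(* K_{n-1}(a_1, ..., a_{n-1}).  The empty sequence gets K_{-1} = 0, the value
   for which the recurrence also holds at n = 1. *)
Definition breveK (s : seq int) : int :=
  if s is x :: s' then continuant (belast x s') else 0.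

(* The third pair and the three integers are carried along but do not occur in
   the value. *)
Definition sigma_tilde (t : (seq int * int) * (seq int * int) * (seq int * int))
  : int :=
  let: ((s1, _), (s2, _), (_, _)) := t in breveK (s1 ++ s2).

(* Main.v *)
Require Import Defs.
From mathcomp Require Import all_boot all_order all_algebra.
From mathcomp Require Import ring.

Set Implicit Arguments.
Unset Strict Implicit.
Unset Printing Implicit Defensive.

Import Order.TTheory GRing.Theory Num.Theory.
Local Open Scope ring_scope.

(** The continuants are entries of a product of the matrices [[x, 1], [1, 0]]:
    [breveK s] is the upper right entry of the product M(s) over [s].  An even
    number of factors makes M(alpha) unimodular, so by Cayley-Hamilton
    M(alpha)^2 = t M(alpha) - 1, with t the trace.  The upper right entries of
    this identity and of its product with M(beta) give
    breveK(alpha^2) = t breveK(alpha) and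
    breveK(alpha^2 beta) = t breveK(alpha beta) - breveK(beta). *)

Lemma mul_mx22E (R : pzSemiRingType) (A B : 'M[R]_2) i j :
  (A *m B) i j = A i 0 * B 0 j + A i 1 * B 1 j.
Proof.
rewrite !mxE !big_ord_recl big_ord0 addr0.
by congr (_ + A i _ * B _ j); apply: val_inj.
Qed.

Lemma det_mx22 (R : comPzRingType) (A : 'M[R]_2) :
  \det A = A 0 0 * A 1 1 - A 0 1 * A 1 0.
Proof.
have lift00 : lift ord0 ord0 = 1 :> 'I_2 by apply: val_inj.
have lift10 : lift 1 ord0 = 0 :> 'I_2 by apply: val_inj.
rewrite (expand_det_row A 0) !big_ord_recl big_ord0 addr0 /cofactor !det_mx11.
by rewrite !mxE lift00 lift10 expr0 expr1 mul1r mulN1r mulrN.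
Qed.

Lemma mx22_sqr_sl2 (R : comNzRingType) (A : 'M[R]_2) :
  \det A = 1 -> A *m A = \tr A *: A - 1%:M.
Proof.
rewrite det_mx22 /mxtrace !big_ord_recl big_ord0 addr0.
rewrite (_ : lift ord0 ord0 = 1); last exact: val_inj.
(* Replacing [1] by the determinant turns each entry into a polynomial identity in the entries of
   [A], free of hypotheses. *)
move=> detA; apply/matrixP => i j; rewrite mul_mx22E !mxE -detA.
have ord2P (k : 'I_2) : k = 0 \/ k = 1.
  by case: k => [[|[|//]] lt_k2]; [left | right]; apply: val_inj.
by case: (ord2P i) (ord2P j) => -> [] ->; rewrite ?mulr1n ?mulr0n; ring.
Qed.

(** Serves to drop last elements: [nth 0 (rcons s x)] and [nth 0 s] agree below [size s] but may
    differ at [size s]. *)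
Lemma eq_continuant_rec (x y : nat -> int) n :
  (forall i, (i < n)%N -> x i = y i) -> continuant_rec x n = continuant_rec y n.
Proof.
elim/ltn_ind: n => [[|[|n]]] IHn eq_xy //=; first exact: eq_xy.
rewrite -!/(continuant_rec _ n.+1) eq_xy // !(IHn n.+1, IHn n) //.
- by move=> i lt_in; rewrite eq_xy // ltnW // ltnW.
- by move=> i lt_in; rewrite eq_xy // ltnW.
Qed.

Lemma breveK_rcons s x : breveK (rcons s x) = continuant s.
Proof. by case: s => //= y s; rewrite belast_rcons. Qed.

Lemma continuant_rcons s x :
  continuant (rcons s x) = x * continuant s + breveK s.
Proof.
case/lastP: s => [|s y]; first by rewrite /continuant /= mulr1 addr0.
rewrite breveK_rcons /continuant !size_rcons /=.
rewrite -!/(continuant_rec _ (size s).+1) nth_rcons size_rcons ltnn eqxx.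
congr (_ * _ + _); apply: eq_continuant_rec => i lt_i.
  by rewrite nth_rcons size_rcons lt_i.
by rewrite !nth_rcons size_rcons lt_i ltnW.
Qed.

Lemma continuant_gt0 s : (forall x, x \in s -> 0 < x) -> 0 < continuant s.
Proof.
(* The recurrence brings in [breveK s], so its sign joins the induction; it is only nonnegative,
   since [breveK [::] = 0]. *)
move=> s_gt0; suff [] : 0 < continuant s /\ 0 <= breveK s by [].
elim/last_ind: s s_gt0 => [|s x IHs] s_gt0 //.
have [|Ks_gt0 bs_ge0] := IHs.
  by move=> y sy; rewrite s_gt0 // mem_rcons inE sy orbT.
rewrite continuant_rcons breveK_rcons ltW // ltr_wpDr // mulr_gt0 //.
by rewrite s_gt0 // mem_rcons mem_head.
Qed.

Lemma breveK_gt0 s : s <> [::] -> (forall x, x \in s -> 0 < x) -> 0 < breveK s.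
Proof.
case/lastP: s => // s x _ s_gt0; rewrite breveK_rcons continuant_gt0 // => y sy.
by rewrite s_gt0 // mem_rcons inE sy orbT.
Qed.

Definition elem_mx (x : int) : 'M[int]_2 :=
  \matrix_(i, j) (if i == 0 then if j == 0 then x else 1 else (j == 0)%:R).

Definition continuant_mx (s : seq int) : 'M[int]_2 := \prod_(x <- s) elem_mx x.

Lemma continuant_mx_cat s t :
  continuant_mx (s ++ t) = continuant_mx s *m continuant_mx t.
Proof. exact: big_cat. Qed.

(** Right multiplication by [elem_mx x] sends a row (p, q) to (x p + q, p), which is the recurrence
    for [rcons s x]; the empty product starts it at (1, 0). *)
Lemma continuant_mx_row0 s :
  continuant_mx s 0 0 = continuant s /\ continuant_mx s 0 1 = breveK s.
Proof.
elim/last_ind: s => [|s x [IH0 IH1]]; first by rewrite /continuant_mx big_nil !mxE.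
rewrite -cats1 continuant_mx_cat /continuant_mx big_seq1 !mul_mx22E IH0 IH1 !mxE /=.
by rewrite cats1 continuant_rcons breveK_rcons !mulr1 mulr0 addr0 mulrC.
Qed.

Lemma breveK_mx s : breveK s = continuant_mx s 0 1.
Proof. by case: (continuant_mx_row0 s). Qed.

(** Each factor has determinant -1. *)
Lemma det_continuant_mx s : \det (continuant_mx s) = (-1) ^+ size s.
Proof.
elim: s => [|x s IHs]; first by rewrite /continuant_mx big_nil det1.
rewrite -cat1s continuant_mx_cat det_mulmx IHs /continuant_mx big_seq1 exprS.
by rewrite det_mx22 !mxE /= mulr0 mulr1 sub0r.
Qed.

Theorem corollary7p19 (alpha beta : seq int) (a b c : int)
  (alpha_pos : forall x, x \in alpha -> 0 < x)
  (beta_pos : forall x, x \in beta -> 0 < x)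
  (alpha_even : ~~ odd (size alpha))
  (beta_even : ~~ odd (size beta))
  (alpha_nonempty : alpha <> [::])
  (ha : a = breveK alpha)
  (hb : b = breveK (alpha ++ beta))
  (hc : c = breveK beta) :
  (sigma_tilde ((alpha, a), (alpha ++ beta, b), (beta, c)))%:Q
  = (breveK (alpha ++ alpha))%:Q / (breveK alpha)%:Q * b%:Q - c%:Q.
Proof.
(* Positive entries and [alpha <> [::]] make the denominator positive. *)
have Ka_neq0 : (breveK alpha)%:Q != 0 by rewrite intr_eq0 gt_eqF ?breveK_gt0.
have sqr_alpha : continuant_mx alpha *m continuant_mx alpha
    = \tr (continuant_mx alpha) *: continuant_mx alpha - 1%:M.
  by apply: mx22_sqr_sl2; rewrite det_continuant_mx -signr_odd (negPf alpha_even).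
set t := \tr _ in sqr_alpha.
(* The identity matrix contributes 0 to the upper right entry. *)
have -> : breveK (alpha ++ alpha) = t * breveK alpha.
  by rewrite !breveK_mx continuant_mx_cat sqr_alpha !mxE subr0.
have -> : sigma_tilde ((alpha, a), (alpha ++ beta, b), (beta, c)) = t * b - c.
  rewrite hb hc /= !breveK_mx !continuant_mx_cat mulmxA sqr_alpha.
  rewrite mulmxBl mul1mx -scalemxAl.
  (* Generalizing the product keeps [mxE] from expanding it into a sum. *)
  by move: (_ *m _) => AB; rewrite !mxE.
by rewrite !rmorphM rmorphB rmorphM /= mulfK.
Qed.
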